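(* Let $(X,d)$ be a finite metric space with points $x_1,\ldots,x_n$, where $n\ge 2$. For $p\ge 0$ let $D_p=\left[d(x_i,x_j)^p\right]_{1\le i,j\le n}$ be the $p$-distance matrix (with the convention that the diagonal entries are $0$ for every $p\ge 0$, including $p=0$). Assume that every row of $D_1$ is a permutation of the first row of $D_1$. Let $H=\{\alpha\in\mathbb{R}^n:\langle \alpha,\mathbb{1}\rangle=0\}$, where $\mathbb{1}$ is the all-ones vector. Then: (1) $\mathfrak{q}(X,d)=\inf\{p\ge 0:\det(D_p)=0\}$. (2) If $q:=\mathfrak{q}(X,d)<\infty$, then for $\mathbf{u}\in\mathbb{R}^n$ we have ($\mathbf{u}\in H$ and $\mathbf{u}^T D_q\mathbf{u}=0$) if and only if $D_q\mathbf{u}=\mathbf{0}$.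
   Context: For $p\ge 0$, a metric space $(X,d)$ has generalized roundness exponent $p$ if for all $m\in\mathbb{N}$ and all points $a_1,\ldots,a_m,b_1,\ldots,b_m\in X$, $\sum_{1\le k<l\le m}\{d(a_k,a_l)^p+d(b_k,b_l)^p\}\le \sum_{1\le j,i\le m} d(a_j,b_i)^p$. The generalized roundness $\mathfrak{q}(X,d)$ is the supremum of all generalized roundness exponents of $(X,d)$. Equivalently, $p$ is a generalized roundness exponent iff $(X,d)$ has $p$-negative type, i.e. $\sum_{i,j} d(x_i,x_j)^p\eta_i\eta_j\le 0$ for all finite $\{x_1,\dots,x_m\}\subseteq X$ and reals $\eta_i$ with $\sum\eta_i=0$. *)

(* Defs.v *)
From HB Require Import structures.
From mathcomp Require Import all_boot all_order all_algebra.
From mathcomp Require Import all_classical all_reals all_analysis.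
Set Implicit Arguments. Unset Strict Implicit. Unset Printing Implicit Defensive.
Import Order.TTheory GRing.Theory Num.Theory.
Local Open Scope ring_scope.

(* Power with the convention 0^p = 0 for every p >= 0 (including p = 0),
   as in the paper (diagonal entries of D_p are 0). For x > 0 it is powR. *)
Definition dpow {R : realType} (x p : R) : R := if x == 0 then 0 else powR x p.

Definition is_metric {R : realType} {X : Type} (d : X -> X -> R) : Prop :=
  (forall x y, d x y = 0 <-> x = y) /\
  (forall x y, d x y = d y x) /\
  (forall x y z, d x z <= d x y + d y z).

Definition gr_exponent {R : realType} {X : Type} (d : X -> X -> R) (p : R) : Prop :=
  0 <= p /\
  forall (m : nat) (a b : 'I_m -> X),
    \sum_(k < m) \sum_(l < m | (k < l)%N)
        (dpow (d (a k) (a l)) p + dpow (d (b k) (b l)) p)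
    <= \sum_(j < m) \sum_(i < m) dpow (d (a j) (b i)) p.

Definition genroundness {R : realType} {X : Type} (d : X -> X -> R) : \bar R :=
  ereal_sup [set (p%:E)%E | p in [set p : R | gr_exponent d p]].

Definition distmx {R : realType} {n : nat} (d : 'I_n -> 'I_n -> R) (p : R)
  : 'M[R]_n := \matrix_(i, j) dpow (d i j) p.

(* Main.v *)
(** The key fact is a strict form of Schoenberg's theorem: if [D_q] is negative
    semidefinite on the hyperplane [H] of zero-sum vectors, then [D_p] is negative definite
    on [H] for [0 <= p < q].  Writing [A = D_q] and [a = p / q], the entrywise power [A ^ a]
    is the limit, as [t] tends to [0], of [((1 - exp (- t A)) / t) ^ a], and the binomial
    series [(1 - y) ^ a = 1 - sum_k c_k y ^ k] has [c_k > 0], while the kernels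
    [exp (- k t A)] are positive semidefinite and tend to the identity as [k t] grows;
    the tail of [sum_k c_k] is of order [K ^ (- a)], which compensates the factor
    [t ^ (- a)] and keeps the limit away from [0].

    The constant row sums make [D_p] preserve [H], and a kernel vector of [D_p] lies in [H].
    So [det D_p <> 0] whenever [p] is below an exponent of negative type.  At the supremum
    [q] negative type still holds by continuity; if [D_q] were invertible, it would be
    negative definite on [H], a condition that persists for slightly larger exponents. *)
Require Import Defs.
From HB Require Import structures.
From mathcomp Require Import all_boot all_order all_algebra.
From mathcomp Require Import all_classical all_reals all_analysis.
From mathcomp Require Import ring lra zify.
Import Order.TTheory GRing.Theory Num.Theory.
Import numFieldNormedType.Exports.
Local Open Scope ring_scope.

(** * Quadratic forms and Schur products *)

Definition qform {R : realType} {I : finType} (A : I -> I -> R) (x : I -> R) : R :=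
  \sum_i \sum_j x i * x j * A i j.

Definition psd {R : realType} {I : finType} (A : I -> I -> R) : Prop :=
  forall x, 0 <= qform A x.

Definition negtype {R : realType} {I : finType} (A : I -> I -> R) : Prop :=
  forall x, \sum_i x i = 0 -> qform A x <= 0.

(** Positive semidefiniteness witnessed by finitely many rank-one kernels; in this form an entrywise
    product splits into diagonal rescalings of the other factor. *)
Definition gram {R : realType} {I : finType} (A : I -> I -> R) : Prop :=
  exists s : seq (I -> R), forall i j, A i j = \sum_(v <- s) v i * v j.

Lemma eq_qform {R : realType} {I : finType} (A B : I -> I -> R) (x : I -> R) :
  (forall i j, A i j = B i j) -> qform A x = qform B x.
Proof.
by move=> AB; apply: eq_bigr => i _; apply: eq_bigr => j _; rewrite AB.
Qed.

Lemma qform_scale {R : realType} {I : finType} (A : I -> I -> R) (c x : I -> R) :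
  qform (fun i j => c i * c j * A i j) x = qform A (fun i => c i * x i).
Proof. by apply: eq_bigr => i _; apply: eq_bigr => j _; ring. Qed.

Lemma qform_sum {R : realType} {I : finType} {T : Type} (s : seq T)
    (A : T -> I -> I -> R) (x : I -> R) :
  qform (fun i j => \sum_(t <- s) A t i j) x = \sum_(t <- s) qform (A t) x.
Proof.
rewrite exchange_big; apply: eq_bigr => i _; rewrite exchange_big.
by apply: eq_bigr => j _; rewrite mulr_sumr.
Qed.

Lemma qformZ {R : realType} {I : finType} (A : I -> I -> R) (c : R) (x : I -> R) :
  qform (fun i j => c * A i j) x = c * qform A x.
Proof.
rewrite mulr_sumr; apply: eq_bigr => i _; rewrite mulr_sumr.
by apply: eq_bigr => j _; ring.
Qed.

Lemma qformD {R : realType} {I : finType} (A B : I -> I -> R) (x : I -> R) :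
  qform (fun i j => A i j + B i j) x = qform A x + qform B x.
Proof.
rewrite -big_split; apply: eq_bigr => i _ /=; rewrite -big_split.
by apply: eq_bigr => j _ /=; ring.
Qed.

Lemma qform_diag {R : realType} {I : finType} (c : R) (x : I -> R) :
  qform (fun i j => if i == j then c else 0) x = c * \sum_i x i ^+ 2.
Proof.
rewrite mulr_sumr; apply: eq_bigr => i _.
rewrite (bigD1 i) //= eqxx big1 ?addr0; first by ring.
by move=> j; rewrite eq_sym => /negPf ->; rewrite mulr0.
Qed.

Lemma qform_const {R : realType} {I : finType} (c : R) (x : I -> R) :
  qform (fun _ _ => c) x = c * (\sum_i x i) ^+ 2.
Proof.
rewrite expr2 mulr_suml mulr_sumr; apply: eq_bigr => i _.
by rewrite !mulr_sumr; apply: eq_bigr => j _; ring.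
Qed.

Lemma qform_row {R : realType} {I : finType} (f x : I -> R) :
  qform (fun i _ => f i) x = (\sum_i f i * x i) * \sum_j x j.
Proof.
rewrite mulr_suml; apply: eq_bigr => i _; rewrite mulr_sumr.
by apply: eq_bigr => j _; ring.
Qed.

Lemma qform_col {R : realType} {I : finType} (f x : I -> R) :
  qform (fun _ j => f j) x = (\sum_i f i * x i) * \sum_j x j.
Proof.
by rewrite -qform_row /qform exchange_big; apply: eq_bigr => i _;
  apply: eq_bigr => j _; ring.
Qed.

Lemma qform_outer {R : realType} {I : finType} (v x : I -> R) :
  qform (fun i j => v i * v j) x = (\sum_i v i * x i) ^+ 2.
Proof.
rewrite expr2 mulr_suml; apply: eq_bigr => i _; rewrite mulr_sumr.
by apply: eq_bigr => j _; ring.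
Qed.

Lemma qform_line {R : realType} {I : finType} (A : I -> I -> R) (x y : I -> R) (t : R) :
  (forall i j, A i j = A j i) ->
  qform A (fun i => x i + t * y i) =
  qform A x + 2 * t * (\sum_i y i * \sum_j A i j * x j) + t ^+ 2 * qform A y.
Proof.
move=> symA.
pose b := \sum_i \sum_j y i * x j * A i j.
have -> : \sum_i y i * (\sum_j A i j * x j) = b.
  by apply: eq_bigr => i _; rewrite mulr_sumr; apply: eq_bigr => j _; ring.
have b' : \sum_i \sum_j x i * y j * A i j = b.
  rewrite exchange_big; apply: eq_bigr => i _; apply: eq_bigr => j _.
  by rewrite symA; ring.
have -> : 2 * t * b = t * \sum_i \sum_j x i * y j * A i j + t * b.
  by rewrite b'; ring.
rewrite /b /qform !mulr_sumr -!big_split; apply: eq_bigr => i _ /=.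
rewrite !mulr_sumr -!big_split; apply: eq_bigr => j _ /=; ring.
Qed.

(** Evaluate at the vertex t = - b / c when c < 0; when c = 0, a nonzero b would let the linear
    function reach 1. *)
Lemma quadratic_le0 {R : realType} (a b c : R) :
  c <= 0 -> (forall t, a + 2 * t * b + t ^+ 2 * c <= 0) -> b ^+ 2 <= a * c.
Proof.
move=> cle H; have [c0|c0] := eqVneq c 0.
  have [->|b0] := eqVneq b 0; first by rewrite c0 expr2 !mulr0.
  have := H ((1 - a) / (2 * b)); rewrite c0 mulr0 addr0.
  have -> : a + 2 * ((1 - a) / (2 * b)) * b = 1 by field.
  by rewrite ler10.
have clt : c < 0 by rewrite lt_neqAle c0.
have := H (- b / c).
have -> : a + 2 * (- b / c) * b + (- b / c) ^+ 2 * c = (a * c - b ^+ 2) / c by field.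
by rewrite ler_ndivrMr // mul0r subr_ge0.
Qed.

Lemma negtype_cauchy {R : realType} {I : finType} (A : I -> I -> R) (x y : I -> R) :
  (forall i j, A i j = A j i) -> negtype A -> \sum_i x i = 0 -> \sum_i y i = 0 ->
  (\sum_i y i * \sum_j A i j * x j) ^+ 2 <= qform A x * qform A y.
Proof.
move=> symA nA x0 y0; apply: quadratic_le0 => [|t]; first exact: nA.
rewrite -qform_line //; apply: nA.
by rewrite big_split /= -mulr_sumr x0 y0 mulr0 addr0.
Qed.

Lemma psd_cauchy {R : realType} {I : finType} (A : I -> I -> R) (x y : I -> R) :
  (forall i j, A i j = A j i) -> psd A ->
  (\sum_i y i * \sum_j A i j * x j) ^+ 2 <= qform A x * qform A y.
Proof.
move=> symA pA.
rewrite -[X in X <= _]sqrrN -[X in _ <= X]mulrNN; apply: quadratic_le0 => [|t].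
  by rewrite oppr_le0 pA.
have := pA (fun i => x i + t * y i); rewrite qform_line //; lra.
Qed.

Lemma qform_delta {R : realType} {I : finType} (A : I -> I -> R) (i : I) :
  qform A (fun k => (k == i)%:R) = A i i.
Proof.
rewrite /qform (bigD1 i) //= [X in _ + X]big1 ?addr0; last first.
  by move=> k /negPf ->; rewrite big1 // => j _; rewrite !mul0r.
rewrite (bigD1 i) //= big1 ?addr0; first by rewrite eqxx !mul1r.
by move=> k /negPf ->; rewrite mulr0 mul0r.
Qed.

Lemma sum_delta {R : pzRingType} {I : finType} (f : I -> R) (i : I) :
  \sum_j f j * (j == i)%:R = f i.
Proof.
rewrite (bigD1 i) //= big1 ?addr0; first by rewrite eqxx mulr1.
by move=> k /negPf ->; rewrite mulr0.
Qed.

(* Lagrange reduction: each square splits off one nonzero diagonal entry. *)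
Lemma psd_gram {R : realType} {I : finType} (A : I -> I -> R) :
  (forall i j, A i j = A j i) -> psd A -> gram A.
Proof.
(* Induction on a bound N for the number of nonzero diagonal entries; the case N = 0 is treated
   last. *)
move: {2}(#|[set i | A i i != 0%R]|) (leqnn #|[set i | A i i != 0%R]|) => N.
elim: N A => [|N IH] A hN symA pA; first last.
  have [[i Ai]|none] := pselect (exists i, A i i != 0); last first.
    apply: IH => //; rewrite (_ : [set i | _] = finset.set0) ?cards0 //.
    apply/setP => i; rewrite !inE; apply/negbTE/negP => Ai.
    by apply: none; exists i.
  have Ap : 0 < A i i by rewrite lt_neqAle eq_sym Ai -qform_delta pA.
  pose B := fun j k => A j k - A j i * A k i / A i i.
  have pB : psd B.
    move=> x.
    have -> : qform B x = qform A x - (\sum_k A k i * x k) ^+ 2 / A i i.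
      rewrite (@eq_qform _ _ B (fun j k => A j k + (- (A i i)^-1) * (A j i * A k i))).
        by rewrite qformD qformZ qform_outer; ring.
      by move=> j k; rewrite /B; ring.
    rewrite subr_ge0 ler_pdivrMr //.
    have := psd_cauchy A x (fun k => (k == i)%:R) symA pA.
    rewrite qform_delta; apply: le_trans; rewrite le_eqVlt; apply/orP; left; apply/eqP.
    congr (_ ^+ 2); under [RHS]eq_bigr do rewrite mulrC.
    by rewrite sum_delta; apply: eq_bigr => k _; rewrite symA.
  have [||s hs] := IH B _ _ pB.
  (* [B] vanishes at (i, i), and a zero [A j j] stays zero because [B j j] is then both nonpositive
     and nonnegative. *)
  - have sub : [set j | B j j != 0%R] \subset [set j | A j j != 0%R] :\ i.
      apply/fintype.subsetP => j; rewrite !inE => Bj; apply/andP; split.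
        by apply: contra Bj => /eqP ->; apply/eqP; rewrite /B; field.
      apply: contra Bj => /eqP Aj; have := pB (fun k => (k == j)%:R).
      rewrite qform_delta /B Aj sub0r oppr_ge0 => h; apply/eqP.
      apply/eqP; rewrite oppr_eq0 eq_le h /=.
      by rewrite divr_ge0 ?(ltW Ap) // -expr2 sqr_ge0.
    move: (subset_leq_card sub) hN; rewrite (cardsD1 i [set j | A j j != 0%R]).
    by rewrite inE Ai add1n ltnS => h1 h2; apply: leq_trans h2.
  - by move=> j k; rewrite /B symA; ring.
  exists ((fun j => A j i / Num.sqrt (A i i)) :: s) => j k.
  rewrite big_cons -hs /B.
  have -> : A j i / Num.sqrt (A i i) * (A k i / Num.sqrt (A i i)) =
            A j i * A k i / (Num.sqrt (A i i)) ^+ 2.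
    by rewrite expr2 invfM; ring.
  by rewrite sqr_sqrtr ?(ltW Ap) //; ring.
(* With a zero diagonal, Cauchy-Schwarz on basis vectors kills every entry, so the empty sum
   works. *)
have Aii i : A i i = 0.
  apply/eqP/negPn/negP => Ai; move: hN; rewrite leqn0 cards_eq0 => /eqP/setP/(_ i).
  by rewrite !inE Ai.
exists [::] => i j; rewrite big_nil.
have := psd_cauchy A (fun k => (k == j)%:R) (fun k => (k == i)%:R) symA pA.
rewrite !qform_delta Aii mul0r.
under eq_bigr => k _ do rewrite sum_delta mulrC.
rewrite sum_delta => h; apply/eqP; rewrite -sqrf_eq0 eq_le h /=.
by rewrite sqr_ge0.
Qed.

(** Each rank-one term v of [A] contributes the form of [B] at the entrywise product of v and x. *)
Lemma schur_product {R : realType} {I : finType} (A B : I -> I -> R) :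
  gram A -> psd B -> psd (fun i j => A i j * B i j).
Proof.
move=> [s hs] pB x.
rewrite (@eq_qform _ _ _ (fun i j => \sum_(v <- s) v i * v j * B i j)).
  by rewrite qform_sum sumr_ge0 // => v _; rewrite qform_scale.
by move=> i j; rewrite hs mulr_suml.
Qed.

Lemma psd_exp {R : realType} {I : finType} (A : I -> I -> R) (k : nat) :
  gram A -> psd (fun i j => A i j ^+ k).
Proof.
move=> gA; elim: k => [|k IH] x.
  by rewrite (@eq_qform _ _ _ (fun _ _ => 1)) // qform_const mul1r sqr_ge0.
rewrite (@eq_qform _ _ _ (fun i j => A i j * A i j ^+ k)); last first.
  by move=> i j; rewrite exprS.
exact: schur_product.
Qed.

Lemma qform_cvg {R : realType} {I : finType} {T : Type} (F : set_system T) {FF : Filter F}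
    (A : T -> I -> I -> R) (B : I -> I -> R) (x : I -> R) :
  (forall i j, A t i j @[t --> F] --> B i j)%classic ->
  (qform (A t) x @[t --> F] --> qform B x)%classic.
Proof.
move=> AB; apply: cvg_big => // [|i _]; first exact: add_continuous.
apply: cvg_big => // [|j _]; first exact: add_continuous.
by apply: cvgMl_tmp.
Qed.

(** Partial sums of the exponential series are nonnegative combinations of entrywise powers, and
    nonnegativity passes to the limit. *)
Lemma psd_expR {R : realType} {I : finType} (A : I -> I -> R) :
  gram A -> psd (fun i j => expR (A i j)).
Proof.
move=> gA x.
have := @qform_cvg R I nat \oo%classic _
  (fun N i j => (series (exp_coeff (A i j)) N : R)) (fun i j => expR (A i j)) x.
move=> /(_ _) h.
apply: (cvgr_to_ge (h _)) => [i j|]; first exact: is_cvg_series_exp_coeff.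
near=> N; rewrite /series /= qform_sum sumr_ge0 // => k _.
rewrite (@eq_qform _ _ _ (fun i j => (k`!%:R^-1) * A i j ^+ k)); last first.
  by move=> i j; rewrite /exp_coeff /= mulrC.
by rewrite qformZ mulr_ge0 // psd_exp.
Unshelve. all: by end_near. Qed.

(** * The binomial series *)

(** This is (-1)^K binom(a - 1, K). For 0 < a < 1 it is the sum of the c_k with k > K, where (1 -
    y)^a = 1 - sum_k c_k y^k. *)
Definition binrem {R : realType} (a : R) (K : nat) : R :=
  \prod_(k < K) (1 - a / k.+1%:R).

Lemma binrem0 {R : realType} (a : R) : binrem a 0 = 1.
Proof. exact: big_ord0. Qed.

Lemma binremS {R : realType} (a : R) (K : nat) :
  binrem a K.+1 = binrem a K * (1 - a / K.+1%:R).
Proof. exact: big_ord_recr. Qed.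

Lemma binrem_ge0 {R : realType} (a : R) (K : nat) : 0 < a < 1 -> 0 <= binrem a K.
Proof.
move=> /andP[a0 a1]; apply: prodr_ge0 => k _.
by rewrite subr_ge0 ler_pdivrMr // mul1r (le_trans (ltW a1)) // ler1n.
Qed.

Lemma binrem_decr {R : realType} (a : R) (K : nat) :
  0 < a < 1 -> binrem a K.+1 <= binrem a K.
Proof.
move=> h; rewrite binremS ler_piMr ?binrem_ge0 //.
by case/andP: h => a0 _; rewrite gerBl divr_ge0 // ltW.
Qed.

Lemma binrem_le1 {R : realType} (a : R) (K : nat) : 0 < a < 1 -> binrem a K <= 1.
Proof.
move=> h; elim: K => [|K]; first by rewrite binrem0.
by apply: le_trans; apply: binrem_decr.
Qed.

(** Young's inequality for the product of u^a and 1, with conjugate exponents 1 / a and 1 / (1 -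
    a). *)
Lemma powR_bernoulli {R : realType} (a u : R) :
  0 < a < 1 -> 0 <= u -> u `^ a <= 1 + a * (u - 1).
Proof.
move=> /andP[a0 a1] u0.
have b0 : 0 < 1 - a by rewrite subr_gt0.
have := @conjugate_powR R (u `^ a) 1 a^-1 (1 - a)^-1.
rewrite !invrK powR1 -powRrM mulfV ?gt_eqF // powRr1 //.
move=> /(_ (powR_ge0 _ _) ler01); rewrite !invr_gt0 a0 b0 => /(_ isT isT).
by rewrite addrC subrK => /(_ erefl); lra.
Qed.

(** The right-hand side is nondecreasing in K, by [powR_bernoulli] at u = (K + 1) / (K + 2), and
    starts at 1 - a. *)
Lemma binrem_lower {R : realType} (a : R) (K : nat) :
  0 < a < 1 -> (1 - a) <= binrem a K.+1 * K.+1%:R `^ a.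
Proof.
move=> h; elim: K => [|K IH].
  by rewrite binremS binrem0 powR1 divr1 mul1r mulr1.
apply: (le_trans IH); rewrite [binrem a K.+2]binremS -mulrA.
apply: ler_wpM2l; first exact: binrem_ge0.
have K2 : (0 : R) < K.+2%:R by rewrite ltr0n.
have -> : (K.+1%:R : R) = K.+1%:R / K.+2%:R * K.+2%:R by rewrite divfK ?gt_eqF.
rewrite powRM ?divr_ge0 ?ler0n //; apply: ler_wpM2r; first exact: powR_ge0.
apply: le_trans (powR_bernoulli _ _ h _) _; first by rewrite divr_ge0 ?ler0n.
rewrite le_eqVlt; apply/orP; left; apply/eqP.
rewrite -[K.+2]addn1 natrD in K2 *; field.
by rewrite gt_eqF.
Qed.

(** The binomial series of (1 - y)^a cut at degree K; its coefficients are written as differences so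
    that the value at 1 telescopes. *)
Definition binpoly {R : realType} (a : R) (K : nat) : {poly R} :=
  1 - \sum_(k < K) (binrem a k - binrem a k.+1) *: 'X^(k.+1).

Lemma horner_binpoly {R : realType} (a : R) (K : nat) (y : R) :
  (binpoly a K).[y] = 1 - \sum_(k < K) (binrem a k - binrem a k.+1) * y ^+ k.+1.
Proof.
rewrite /binpoly !hornerE horner_sum; congr (_ - _); apply: eq_bigr => k _.
by rewrite !hornerE.
Qed.

Lemma binpoly_at1 {R : realType} (a : R) (K : nat) : (binpoly a K).[1] = binrem a K.
Proof.
rewrite horner_binpoly; under eq_bigr do rewrite expr1n mulr1.
elim: K => [|K IH]; first by rewrite big_ord0 subr0 binrem0.
by rewrite big_ord_recr /= opprD addrA IH; ring.
Qed.

(* [(1 - y) S' + a S] vanishes for [S y = (1 - y) ^ a], so this is the defect of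
   the truncated binomial series as a solution of that differential equation. *)
Lemma binpoly_ode {R : realType} (a : R) (K : nat) (y : R) :
  (1 - y) * (binpoly a K)^`().[y] + a * (binpoly a K).[y] = a * binrem a K * y ^+ K.
Proof.
elim: K => [|K IH].
  by rewrite /binpoly big_ord0 subr0 derivC !hornerE binrem0 mulr1.
have -> : binpoly a K.+1 = binpoly a K - (binrem a K - binrem a K.+1) *: 'X^(K.+1).
  by rewrite /binpoly big_ord_recr /= opprD addrA.
move: (binpoly a K) IH => p IH; rewrite derivB derivZ derivXn /=.
rewrite !hornerD !hornerN !hornerZ hornerMn !hornerXn.
transitivity (a * binrem a K * y ^+ K
    - (1 - y) * ((binrem a K - binrem a K.+1) * (y ^+ K *+ K.+1))
    - a * ((binrem a K - binrem a K.+1) * y ^+ K.+1)).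
  by rewrite -IH; ring.
rewrite binremS exprS -(mulr_natr (y ^+ K)).
have : K.+1%:R != 0 :> R by rewrite pnatr_eq0.
by move: (K.+1%:R) => n n0; field.
Qed.

(** By [binpoly_ode], the derivative of S_K(z) (1 - z)^(-a) is a constant times z^K (1 - z)^(-a -
    1), so the mean value theorem on [0, y] keeps this function within O(y^K) of its value 1 at
    0. *)
Lemma binpoly_cvg {R : realType} (a y : R) :
  0 < a < 1 -> 0 < y < 1 ->
  ((binpoly a K).[y] @[K --> \oo] --> (1 - y) `^ a)%classic.
Proof.
move=> ha /andP[y0 y1].
pose C := a * (1 - y) `^ (- a - 1) * y.
have y1' : 0 < 1 - y by rewrite subr_gt0.
have bound K : 0 <= (binpoly a K).[y] * (1 - y) `^ (- a) - 1 <= C * y ^+ K.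
  pose F := fun z : R => (binpoly a K).[z] * (1 - z) `^ (- a).
  pose dF := fun z : R => a * binrem a K * z ^+ K * (1 - z) `^ (- a - 1).
  have derF (x : R) : x < 1 -> is_derive x 1 F (dF x).
    move=> x1; have x1' : 0 < 1 - x by rewrite subr_gt0.
    have d1 : is_derive x 1 (fun z : R => 1 - z) (-1).
      have := is_deriveB (is_derive_cst (1 : R) x (1 : R)) (is_derive_id x (1 : R)).
      by rewrite sub0r.
    have d2 : is_derive x 1 ((fun w : R => w `^ (- a)) \o (fun z : R => 1 - z))
        (- a * (1 - x) `^ (- a - 1) * (-1)).
      exact: (@is_derive1_comp R (fun w : R => w `^ (- a)) (fun z : R => 1 - z) x
        _ _ (is_derive1_powR (- a) x1') d1).
    have d3 := is_derive_poly (binpoly a K) x.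
    apply: (is_derive_eq (is_deriveM d3 d2)).
    rewrite /dF -binpoly_ode /= /GRing.scale /=.
    have -> : (1 - x) `^ (- a) = (1 - x) * (1 - x) `^ (- a - 1).
      have {1}-> : - a = 1 + (- a - 1) by ring.
      by rewrite powRD ?powRr1 ?(ltW x1') // (gt_eqF x1') implybT.
    by ring.
  have [|z|c] := @MVT R F dF 0 y y0.
  - by move=> x; rewrite in_itv /= => /andP[_ xy]; apply: derF; apply: lt_trans y1.
  - apply: derivable_within_continuous => x; rewrite in_itv /= => /andP[_ xy].
    by have /derF[] : x < 1 by apply: le_lt_trans y1.
  rewrite in_itv /= => /andP[c0 cy].
  have -> : F 0 = 1.
    rewrite /F subr0 powR1 mulr1 horner_binpoly big1 ?subr0 //.
    by move=> k _; rewrite expr0n mulr0.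
  rewrite subr0 -/(F y) => ->.
  have c1 : 0 < 1 - c by rewrite subr_gt0 (lt_trans cy).
  have a0 : 0 <= a by case/andP: ha => /ltW.
  apply/andP; split.
    by rewrite !mulr_ge0 ?binrem_ge0 ?exprn_ge0 ?powR_ge0 // ltW.
  (* Since c < y, both factors z^K and (1 - z)^(-a - 1) at c are at most their values at y. *)
  rewrite /dF /C [leRHS](_ : _ = a * y ^+ K * (1 - y) `^ (- a - 1) * y); last by ring.
  apply: ler_wpM2r; first exact: ltW.
  apply: ler_pM; rewrite ?powR_ge0 ?mulr_ge0 ?exprn_ge0 ?binrem_ge0 ?(ltW c0) //.
    rewrite -mulrA; apply: ler_wpM2l => //.
    apply: le_trans (_ : c ^+ K <= _); last first.
      by rewrite lerXn2r ?nnegrE ?ltW.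
    by rewrite ler_piMl ?exprn_ge0 ?(ltW c0) // binrem_le1.
  have -> : - a - 1 = - (a + 1) by ring.
  rewrite !powRN lef_pV2 ?posrE ?powR_gt0 //.
  by rewrite ge0_ler_powR ?nnegrE ?(ltW c1) ?(ltW y1') ?addr_ge0 // lerB // ltW.
have gc : (C * y ^+ K @[K --> \oo] --> (0 : R))%classic.
  by apply: (@cvg_geometric R C y); rewrite gtr0_norm.
have h1 : ((binpoly a K).[y] * (1 - y) `^ (- a) - 1 @[K --> \oo] --> (0 : R))%classic.
  apply: (@squeeze_cvgr _ _ _ _ (fun=> 0) (fun K => C * y ^+ K)) => //.
    by near=> K; exact: bound.
  exact: cvg_cst.
have -> : (fun K => (binpoly a K).[y]) = (fun K => (1 - y) `^ a *
    ((binpoly a K).[y] * (1 - y) `^ (- a) - 1 + 1)).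
  apply/funext => K; rewrite subrK powRN mulrCA mulfV ?mulr1 //.
  by rewrite gt_eqF ?powR_gt0.
have : ((binpoly a K).[y] * (1 - y) `^ (- a) - 1 + 1 @[K --> \oo] --> 0 + (1 : R))%classic.
  by apply: cvgD => //; exact: cvg_cst.
by rewrite add0r => /(@cvgMl_tmp _ _ _ _ _ ((1 - y) `^ a)); rewrite mulr1; apply.
Unshelve. all: by end_near. Qed.

(** * Schoenberg's theorem *)

(* Schoenberg: with the base point [i0], [G i j = A i i0 + A i0 j - A i j] is positive
   semidefinite, and [exp (- A)] is a diagonal rescaling of [exp G]. *)
Lemma negtype_expR {R : realType} {I : finType} (A : I -> I -> R) :
  (forall i j, A i j = A j i) -> (forall i, A i i = 0) -> negtype A ->
  psd (fun i j => expR (- A i j)).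
Proof.
move=> symA A0 nA x.
have [i0 _|none] := pickP (fun _ : I => true); last first.
  by rewrite /qform big1 // => i; have := none i.
pose G i j := A i i0 + A i0 j - A i j.
have gG : gram G.
  apply: psd_gram => [i j|y]; first by rewrite /G (symA i j) (symA i i0) (symA j i0); ring.
  pose s := \sum_i y i.
  (* Correcting y at [i0] makes its sum zero, and the form of [A] there equals minus the form of [G]
     at y. *)
  have := nA (fun i => y i + - s * (i == i0)%:R).
  rewrite big_split /= -mulr_sumr.
  have -> : \sum_i (i == i0)%:R = 1 :> R.
    by have := sum_delta (fun=> 1 : R) i0; under eq_bigr do rewrite mul1r.
  rewrite mulr1 subrr => /(_ erefl).
  rewrite qform_line // qform_delta A0.
  under eq_bigr do rewrite mulrC.
  rewrite sum_delta.
  rewrite (@eq_qform _ _ G (fun i j => (A i0 i + A i0 j) + (-1) * A i j)); last first.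
    by move=> i j; rewrite /G (symA i i0); ring.
  rewrite qformD qformZ qformD qform_row qform_col -/s.
  by set b := \sum_j _; lra.
rewrite (@eq_qform _ _ _ (fun i j => expR (- A i0 i) * expR (- A i0 j) * expR (G i j))).
  by rewrite qform_scale; exact: psd_expR.
by move=> i j; rewrite -!expRD /G (symA i i0); congr expR; ring.
Qed.

Lemma qform_expR_cvg {R : realType} {I : finType} (A : I -> I -> R) (x : I -> R) :
  (forall i, A i i = 0) -> (forall i j, i != j -> 0 < A i j) ->
  (qform (fun i j => expR (- (s * A i j))) x @[s --> +oo] --> \sum_i x i ^+ 2)%classic.
Proof.
move=> A0 Ap.
have := @qform_cvg R I R +oo%classic _ (fun s i j => expR (- (s * A i j)))
  (fun i j => if i == j then 1 else 0) x.
rewrite qform_diag mul1r => lim; apply: lim => i j; case: eqVneq => [->|ij].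
  have -> : (fun s : R => expR (- (s * A j j))) = (fun=> 1).
    by apply/funext => s; rewrite A0 mulr0 oppr0 expR0.
  exact: cvg_cst.
apply: (@cvg_comp _ _ _ (fun s => s * A i j) (fun s => expR (- s)) _ +oo%classic).
  exact: gt0_cvgMly (Ap _ _ ij) cvg_id.
exact: cvgr_expR.
Qed.

(** The constant 1 contributes nothing on zero-sum vectors, no later term is positive, and those
    with k >= L contribute at most - N times coefficients that telescope. *)
Lemma qform_binpoly_le {R : realType} {I : finType} (a : R) (B : I -> I -> R)
    (x : I -> R) (N : R) (L M : nat) :
  0 < a < 1 -> 0 <= N -> \sum_i x i = 0 ->
  (forall k, 0 <= qform (fun i j => B i j ^+ k) x) ->
  (forall k, (L <= k)%N -> N <= qform (fun i j => B i j ^+ k.+1) x) ->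
  qform (fun i j => (binpoly a (L + M)).[B i j]) x
    <= - (N * (binrem a L - binrem a (L + M))).
Proof.
move=> ha N0 x0 pB NB.
rewrite (@eq_qform _ _ _ (fun i j => 1 + (-1) *
  \sum_(k < L + M) (binrem a k - binrem a k.+1) * B i j ^+ k.+1)); last first.
  by move=> i j; rewrite horner_binpoly mulN1r.
rewrite qformD qform_const x0 expr0n mulr0 add0r qformZ mulN1r lerN2 qform_sum.
under eq_bigr do rewrite qformZ.
have dec k : 0 <= binrem a k - binrem a k.+1 by rewrite subr_ge0 binrem_decr.
elim: M => [|M IH].
  rewrite addn0 subrr mulr0 sumr_ge0 // => k _.
  by rewrite mulr_ge0.
rewrite addnS big_ord_recr /=.
have := ler_wpM2l (dec (L + M)%N) (NB _ (leq_addr M L)).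
move: IH; set u := \sum_(k < _) _; set v := qform _ _; lra.
Qed.

Lemma qform_powR_le {R : realType} {I : finType} (a : R) (B : I -> I -> R)
    (x : I -> R) (L : nat) :
  0 < a < 1 -> \sum_i x i = 0 ->
  (forall i, B i i = 1) -> (forall i j, i != j -> 0 < B i j < 1) ->
  (forall k, 0 <= qform (fun i j => B i j ^+ k) x) ->
  (forall k, (L <= k)%N ->
     (\sum_i x i ^+ 2) / 2 <= qform (fun i j => B i j ^+ k.+1) x) ->
  qform (fun i j => if i == j then 0 else (1 - B i j) `^ a) x
    <= - ((\sum_i x i ^+ 2) / 2 * binrem a L).
Proof.
move=> ha x0 B1 Bij pB NB.
have N0 : 0 <= \sum_i x i ^+ 2 by apply: sumr_ge0 => i _; rewrite sqr_ge0.
have lim : (qform (fun i j => if i == j then 0 else (binpoly a K).[B i j]) x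
   @[K --> \oo] --> qform (fun i j => if i == j then 0 else (1 - B i j) `^ a) x)%classic.
  apply: qform_cvg => i j; case: eqVneq => [_|ij]; first exact: cvg_cst.
  by apply: binpoly_cvg => //; exact: Bij.
apply: (cvgr_to_le lim); near=> K.
have -> : K = (L + (K - L))%N by rewrite subnKC //; near: K; exact: nbhs_infty_ge.
set K' := (L + _)%N.
(* On the diagonal the polynomial has value [binrem a K'] instead of 0; removing it more than
   offsets the missing tail beyond K'. *)
rewrite (@eq_qform _ _ _ (fun i j => (binpoly a K').[B i j] +
   if i == j then - binrem a K' else 0)); last first.
  move=> i j; case: eqVneq => [->|_]; last by rewrite addr0.
  by rewrite B1 binpoly_at1 subrr.
rewrite qformD qform_diag.
have := qform_binpoly_le _ _ _ _ L (K - L) ha (divr_ge0 N0 (ler0n R 2)) x0 pB NB.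
have := mulr_ge0 N0 (binrem_ge0 a K' ha).
rewrite -/K'; set N := \sum_i _; set r := binrem a K'; set r' := binrem a L.
by move: (qform _ _) => q; lra.
Unshelve. all: by end_near. Qed.

Lemma expR_quotient_cvg {R : realType} (S b : R) : 0 < S -> 0 < b ->
  ((1 - expR (- (S / k.+1%:R * b))) / (S / k.+1%:R) @[k --> \oo] --> b)%classic.
Proof.
move=> S0 b0.
apply: (@squeeze_cvgr _ _ _ _ (fun k => b - (S * b ^+ 2) * harmonic k) (fun=> b)).
- near=> k.
  have t0 : 0 < S / k.+1%:R by rewrite divr_gt0.
  rewrite /harmonic /= [S * b ^+ 2 / _](_ : _ = S / k.+1%:R * b ^+ 2); last by ring.
  move: (S / _) t0 => t t0; rewrite ler_pdivlMr // ler_pdivrMr //.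
  have tb : 0 < t * b by rewrite mulr_gt0.
  apply/andP; split; last by have := expR_ge1Dx (- (t * b)); lra.
  (* From exp(- w) <= 1 / (1 + w) and (1 - w + w^2) (1 + w) = 1 + w^3, with w = t b. *)
  have : expR (- (t * b)) <= 1 - t * b + (t * b) ^+ 2.
    rewrite expRN.
    apply: (@le_trans _ _ (1 + t * b)^-1).
      by rewrite lef_pV2 ?posrE ?expR_gt0 ?addr_gt0 // expR_ge1Dx.
    rewrite -[leLHS]mul1r ler_pdivrMr ?addr_gt0 //.
    have -> : (1 - t * b + (t * b) ^+ 2) * (1 + t * b) = 1 + (t * b) ^+ 3 by ring.
    by rewrite lerDl exprn_ge0 // ltW.
  by move: (expR _) => e; rewrite expr2; lra.
- have : (b - S * b ^+ 2 * harmonic k @[k --> \oo] --> b - S * b ^+ 2 * 0)%classic.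
    apply: cvgB; first exact: cvg_cst.
    by apply: cvgMl_tmp; exact: cvg_harmonic.
  by rewrite mulr0 subr0.
- exact: cvg_cst.
Unshelve. all: by end_near. Qed.

(** With t = S / (k + 1), every kernel exp(- m t A) with m > k + 1 has form at least N / 2, which
    leaves N / 2 times [binrem a k.+1]. After the factor t^(-a), [binrem_lower] bounds this below by
    N / 2 times (1 - a) / S^a. *)
Lemma negtype_powR {R : realType} {I : finType} (A : I -> I -> R) (a : R) (x : I -> R) :
  (forall i j, A i j = A j i) -> (forall i, A i i = 0) ->
  (forall i j, i != j -> 0 < A i j) -> negtype A -> 0 < a < 1 ->
  \sum_i x i = 0 -> 0 < \sum_i x i ^+ 2 ->
  qform (fun i j => if i == j then 0 else A i j `^ a) x < 0.
Proof.
move=> symA A0 Ap nA ha x0 Npos.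
set N := \sum_i x i ^+ 2 in Npos.
have [S S0 QS] : exists2 S : R, 0 < S & forall s, S <= s ->
    N / 2 <= qform (fun i j => expR (- (s * A i j))) x.
  have /cvgr_ge /(_ (N / 2)) := qform_expR_cvg A x A0 Ap.
  rewrite -/N ltr_pdivrMr // ltr_pMr // ltr1n => /(_ isT) [M [_ hM]].
  exists (`|M| + 1); first by rewrite ltr_wpDl.
  by move=> s hs; apply: hM; have := ler_norm M; lra.
pose t k : R := S / k.+1%:R.
have t0 k : 0 < t k by rewrite divr_gt0.
pose E k i j := if i == j then 0 else ((1 - expR (- (t k * A i j))) / t k) `^ a.
have lim : (qform (E k) x @[k --> \oo]
    --> qform (fun i j => if i == j then 0 else A i j `^ a) x)%classic.
  apply: qform_cvg => i j; rewrite /E; case: eqVneq => [_|ij]; first exact: cvg_cst.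
  apply: (cvg_comp _ (fun w : R => w `^ a) (expR_quotient_cvg S _ S0 (Ap _ _ ij))).
  have [/derivable1_diffP dp _] := is_derive1_powR a (Ap _ _ ij).
  exact: differentiable_continuous dp.
(* A negative bound independent of k, so that strictness survives the limit. *)
apply: (@le_lt_trans _ _ (- (N / 2 * ((1 - a) / S `^ a)))); last first.
  rewrite oppr_lt0 mulr_gt0 ?divr_gt0 ?powR_gt0 // subr_gt0.
  by case/andP: ha.
apply: (cvgr_to_le lim); near=> k.
have expE m i j : expR (- (t k * A i j)) ^+ m = expR (- (m%:R * t k * A i j)).
  by rewrite -expRM_natl; congr expR; ring.
have -> : qform (E k) x = (t k)^-1 `^ a *
    qform (fun i j => if i == j then 0 else (1 - expR (- (t k * A i j))) `^ a) x.
  rewrite -qformZ; apply: eq_qform => i j; rewrite /E; case: eqVneq => [_|ij].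
    by rewrite mulr0.
  rewrite mulrC powRM ?invr_ge0 ?(ltW (t0 k)) // subr_ge0 -expR0 ler_expR.
  by rewrite oppr_le0 mulr_ge0 // ltW // Ap.
have le := qform_powR_le a (fun i j => expR (- (t k * A i j))) x k.+1 ha x0.
apply: (@le_trans _ _ ((t k)^-1 `^ a * (- (N / 2 * binrem a k.+1)))).
  apply: ler_wpM2l; first exact: powR_ge0.
  apply: le => [i|i j ij|m|m km].
  - by rewrite A0 mulr0 oppr0 expR0.
  - rewrite expR_gt0 -expR0 ltr_expR oppr_lt0 mulr_gt0 //; exact: Ap.
  - rewrite (eq_qform _ _ x (expE m)).
    apply: negtype_expR => [i j|i|y y0]; first by rewrite symA.
      by rewrite A0 mulr0.
    rewrite qformZ mulr_ge0_le0 ?nA // mulr_ge0 // ltW //.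
  - rewrite (eq_qform _ _ x (expE m.+1)); apply: QS.
    rewrite /t mulrA ler_pdivlMr // mulrC ler_pM2r // ler_nat.
    exact: leq_trans km _.
rewrite mulrN lerN2 [leRHS]mulrCA; apply: ler_wpM2l.
  by rewrite divr_ge0 // ltW.
have -> : (t k)^-1 `^ a = k.+1%:R `^ a / S `^ a.
  rewrite invf_div powRM ?invr_ge0 ?(ltW S0) //.
  by rewrite -(powR_inv1 (ltW S0)) -powRrM mulN1r powRN.
rewrite mulrAC; apply: ler_wpM2r; first by rewrite invr_ge0 powR_ge0.
by rewrite mulrC; exact: binrem_lower.
Unshelve. all: by end_near. Qed.

(** * Generalized roundness and negative type *)

Lemma sum_fibers {R : realType} {I T : finType} (c : T -> I) (f : I -> R) :
  \sum_i (\sum_t (c t == i)%:R) * f i = \sum_t f (c t).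
Proof.
under eq_bigr do rewrite mulr_suml.
rewrite exchange_big; apply: eq_bigr => t _ /=.
rewrite (bigD1 (c t)) //= eqxx mul1r big1 ?addr0 // => i.
by rewrite eq_sym => /negPf ->; rewrite mul0r.
Qed.

Lemma qform_fibers {R : realType} {I T U : finType} (A : I -> I -> R)
    (c : T -> I) (e : U -> I) :
  \sum_i \sum_j (\sum_t (c t == i)%:R) * (\sum_u (e u == j)%:R) * A i j =
  \sum_t \sum_u A (c t) (e u).
Proof.
rewrite -(sum_fibers c (fun i => \sum_u A i (e u))); apply: eq_bigr => i _.
rewrite -(sum_fibers e (A i)) mulr_sumr; apply: eq_bigr => j _.
by rewrite mulrA.
Qed.

Lemma sum_upper {R : realType} {I : finType} (A : I -> I -> R) (m : nat) (a : 'I_m -> I) :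
  (forall i j, A i j = A j i) -> (forall i, A i i = 0) ->
  \sum_k \sum_l A (a k) (a l) = 2 * \sum_(k < m) \sum_(l < m | (k < l)%N) A (a k) (a l).
Proof.
move=> symA A0.
have e k : \sum_l A (a k) (a l) = \sum_(l < m | (k < l)%N) A (a k) (a l)
   + \sum_(l < m | (l < k)%N) A (a k) (a l).
  rewrite (bigID (fun l : 'I_m => (k < l)%N)) /=; congr (_ + _).
  rewrite (bigD1 k) ?ltnn //= A0 add0r; apply: eq_bigl => l.
  by rewrite -leqNgt ltn_neqAle andbC.
under eq_bigr do rewrite e.
rewrite big_split /= mulr_natl mulr2n; congr (_ + _).
rewrite (exchange_big_dep predT) //=; apply: eq_bigr => k _.
by apply: eq_bigr => l _; rewrite symA.
Qed.

(** The vector counts multiplicities with sign; summing over ordered pairs counts each unordered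
    pair and each cross term twice, whence the factor 2. *)
Lemma qform_signed_fibers {R : realType} {I : finType} (A : I -> I -> R) (m : nat)
    (a b : 'I_m -> I) :
  (forall i j, A i j = A j i) -> (forall i, A i i = 0) ->
  qform A (fun i => (\sum_k (a k == i)%:R) - (\sum_k (b k == i)%:R)) =
  2 * (\sum_(k < m) \sum_(l < m | (k < l)%N) (A (a k) (a l) + A (b k) (b l))
       - \sum_(j < m) \sum_(i < m) A (a j) (b i)).
Proof.
move=> symA A0.
pose mult (c : 'I_m -> I) i : R := \sum_k (c k == i)%:R.
have fib c e : \sum_i \sum_j mult c i * mult e j * A i j = \sum_k \sum_l A (c k) (e l).
  exact: qform_fibers.
have E : qform A (fun i => mult a i - mult b i) =
   \sum_k \sum_l A (a k) (a l) + \sum_k \sum_l A (b k) (b l)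
   - \sum_k \sum_l A (a k) (b l) - \sum_k \sum_l A (b k) (a l).
  clearbody mult; rewrite -!fib -!sumrN -!big_split; apply: eq_bigr => i _ /=.
  by rewrite -!sumrN -!big_split; apply: eq_bigr => j _ /=; ring.
rewrite [LHS]E.
have -> : \sum_k \sum_l A (b k) (a l) = \sum_k \sum_l A (a k) (b l).
  by rewrite exchange_big; apply: eq_bigr => k _; apply: eq_bigr => l _; exact: symA.
rewrite !sum_upper //.
have -> : \sum_(k < m) \sum_(l < m | (k < l)%N) (A (a k) (a l) + A (b k) (b l)) =
   \sum_(k < m) \sum_(l < m | (k < l)%N) A (a k) (a l) +
   \sum_(k < m) \sum_(l < m | (k < l)%N) A (b k) (b l).
  by rewrite -big_split; apply: eq_bigr => k _; rewrite big_split.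
by ring.
Qed.

(** Enumerate the disjoint union of the types ['I_(f i)] and send each element to its index. *)
Lemma realize_fibers {R : realType} {I : finType} (f : I -> nat) (m : nat) :
  (\sum_i f i)%N = m ->
  exists a : 'I_m -> I, forall i, \sum_k (a k == i)%:R = (f i)%:R :> R.
Proof.
have <- : #|{: {i : I & 'I_(f i)}}| = (\sum_i f i)%N.
  rewrite -sum1_card.
  have <- := @sig_big_dep nat 0%N addn I (fun i => 'I_(f i)) predT (fun=> predT)
    (fun _ _ => 1%N).
  by apply: eq_bigr => i _; rewrite sum1_card card_ord.
move=> <-; exists (fun k => tag (enum_val k)) => i.
rewrite -(big_enum_val (fun t : {i : I & 'I_(f i)} => (tag t == i)%:R)) /=.
have <- := @sig_big_dep R 0 +%R I (fun i => 'I_(f i)) predT (fun=> predT)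
  (fun i' _ => (i' == i)%:R).
under eq_bigr do rewrite sumr_const card_ord.
rewrite (bigD1 i) //= big1 ?addr0 ?eqxx // => j /negPf ->.
by rewrite mul0rn.
Qed.

Lemma qform_cvgl {R : realType} {I : finType} {T : Type} (F : set_system T) {FF : Filter F}
    (A : I -> I -> R) (z : T -> I -> R) (x : I -> R) :
  (forall i, z t i @[t --> F] --> x i)%classic ->
  (qform A (z t) @[t --> F] --> qform A x)%classic.
Proof.
move=> zx; apply: cvg_big => // [|i _]; first exact: add_continuous.
apply: cvg_big => // [|j _]; first exact: add_continuous.
by apply: cvgMr_tmp; apply: cvgM.
Qed.

(** Approximate x by rational zero-sum vectors; clearing the common denominator only scales the form
    by a square. *)
Lemma negtype_int {R : realType} {I : finType} (A : I -> I -> R) :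
  (forall z : I -> int, \sum_i z i = 0 -> qform A (fun i => (z i)%:~R) <= 0) ->
  negtype A.
Proof.
move=> H x x0.
have [i0 _|none] := pickP (fun _ : I => true); last first.
  by rewrite /qform big1 // => i; have := none i.
pose w k i : int := Num.floor (k.+1%:R * x i).
(* Rounding down breaks the zero sum; the defect is absorbed at [i0] and, after division by k + 1,
   vanishes in the limit. *)
pose z k i : int := w k i - (\sum_j w k j) * (i == i0)%:R.
have wcvg i : ((w k i)%:~R / k.+1%:R @[k --> \oo] --> x i)%classic.
  apply: (@squeeze_cvgr _ _ _ _ (fun k => x i - harmonic k) (fun=> x i)).
  - near=> k; rewrite /harmonic /=.
    have k0 : (0 : R) < k.+1%:R by [].
    have := floor_le (k.+1%:R * x i).
    have := floorD1_gt (k.+1%:R * x i).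
    rewrite -/(w k i) intrD => h1 h2; rewrite ler_pdivrMr // ler_pdivlMr //.
    rewrite mulrBl mulVf ?gt_eqF // !(mulrC (x i)) h2 andbT.
    by rewrite lerBlDr ltW.
  - have : (x i - harmonic k @[k --> \oo] --> x i - 0)%classic.
      by apply: cvgB; [exact: cvg_cst|exact: cvg_harmonic].
    by rewrite subr0.
  - exact: cvg_cst.
have zcvg i : ((z k i)%:~R / k.+1%:R @[k --> \oo] --> x i)%classic.
  have -> : (fun k => (z k i)%:~R / k.+1%:R) = (fun k => (w k i)%:~R / k.+1%:R
     - (\sum_j (w k j)%:~R / k.+1%:R) * (i == i0)%:R) :> (nat -> R).
    apply/funext => k; rewrite /z rmorphB rmorphM rmorph_sum rmorph_nat /= -mulr_suml.
    by ring.
  have : ((w k i)%:~R / k.+1%:R - (\sum_j (w k j)%:~R / k.+1%:R) * (i == i0)%:R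
     @[k --> \oo] --> x i - (\sum_j x j) * (i == i0)%:R)%classic.
    apply: cvgB => //; apply: cvgMr_tmp; apply: cvg_big => //; exact: add_continuous.
  by rewrite x0 mul0r subr0.
apply: (cvgr_to_le (qform_cvgl _ A (fun k i => (z k i)%:~R / k.+1%:R) x zcvg)).
near=> k.
have -> : qform A (fun i => (z k i)%:~R / k.+1%:R) =
  (k.+1%:R^-1) ^+ 2 * qform A (fun i => (z k i)%:~R).
  rewrite -qformZ; apply: eq_bigr => i _; apply: eq_bigr => j _; ring.
apply: mulr_ge0_le0; first exact: sqr_ge0.
apply: H; rewrite sumrB -mulr_sumr.
have := sum_delta (fun=> 1 : int) i0; under eq_bigr do rewrite mul1r.
by move=> ->; rewrite mulr1 subrr.
Unshelve. all: by end_near. Qed.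

(** A zero-sum integer vector is a difference of two multiplicity vectors of equal total m, hence
    comes from two families of m points; [negtype_int] then reaches real vectors. *)
Lemma gr_exponentE {R : realType} {I : finType} (d : I -> I -> R) (p : R) :
  is_metric d ->
  gr_exponent d p <-> 0 <= p /\ negtype (fun i j => dpow (d i j) p).
Proof.
move=> [d0 [symd _]]; set A := fun i j => dpow (d i j) p.
have symA i j : A i j = A j i by rewrite /A symd.
have A0 i : A i i = 0 by rewrite /A /dpow (proj2 (d0 i i) erefl) eqxx.
split=> -[p0 H]; split=> //.
  apply: negtype_int => z z0.
  pose f i := if z i is Posz n then n else 0%N.
  (* [Negz n] stands for - (n + 1). *)
  pose g i := if z i is Negz n then n.+1 else 0%N.
  have zfg i : z i = (f i)%:Z - (g i)%:Z by rewrite /f /g; case: (z i) => n /=; lia.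
  have fg : (\sum_i f i = \sum_i g i)%N.
    have posz_sum (h : I -> nat) : \sum_i (h i)%:Z = (\sum_i h i)%N%:Z.
      by rewrite -natz natr_sum; apply: eq_bigr => i _; rewrite natz.
    have : \sum_i ((f i)%:Z - (g i)%:Z) = 0.
      by rewrite -[RHS]z0; apply: eq_bigr => i _; rewrite zfg.
    by rewrite sumrB !posz_sum => /eqP; rewrite subr_eq0 => /eqP [].
  have [a ha] := @realize_fibers R I f _ fg.
  have [b hb] := @realize_fibers R I g _ erefl.
  have -> : qform A (fun i => (z i)%:~R) =
    qform A (fun i => (\sum_k (a k == i)%:R) - (\sum_k (b k == i)%:R)).
    apply: eq_bigr => i _; apply: eq_bigr => j _.
    by rewrite !ha !hb !zfg !rmorphB.
  rewrite qform_signed_fibers // pmulr_rle0 // subr_le0; exact: H.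
move=> m a b; rewrite -subr_le0.
have := H (fun i => (\sum_k (a k == i)%:R) - (\sum_k (b k == i)%:R)).
rewrite qform_signed_fibers // pmulr_rle0 //; apply.
have cnt (c : 'I_m -> I) : \sum_i \sum_k (c k == i)%:R = m%:R :> R.
  have := sum_fibers c (fun=> 1 : R); under eq_bigr do rewrite mulr1.
  by move=> ->; rewrite sumr_const card_ord.
by rewrite sumrB !cnt subrr.
Qed.

(** * Distance matrices *)

Lemma qform_norm_le {R : realType} {I : finType} (W : I -> I -> R) (x : I -> R) :
  `|qform W x| <= (\sum_i \sum_j `|W i j|) * \sum_i x i ^+ 2.
Proof.
apply: le_trans (ler_norm_sum _ _ _) _; rewrite mulr_suml; apply: ler_sum => i _.
apply: le_trans (ler_norm_sum _ _ _) _; rewrite mulr_suml; apply: ler_sum => j _.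
rewrite normrM mulrC; apply: ler_wpM2l => //.
have le k : x k ^+ 2 <= \sum_i x i ^+ 2.
  by rewrite (bigD1 k) //= lerDl sumr_ge0 // => l _; rewrite sqr_ge0.
have := le i; have := le j; rewrite ler_norml; move: (\sum_i _) => N hj hi.
have := sqr_ge0 (x i + x j); have := sqr_ge0 (x i - x j).
rewrite sqrrB sqrrD => h1 h2; apply/andP; split; lra.
Qed.

Lemma det0_kernel {R : realType} {n : nat} (A : 'I_n -> 'I_n -> R) :
  (forall i j, A i j = A j i) ->
  \det (\matrix_(i, j) A i j) = 0 <->
  exists2 u : 'I_n -> R, 0 < \sum_i u i ^+ 2 & forall i, \sum_j A i j * u j = 0.
Proof.
move=> symA; split.
  move/eqP/det0P => [v v0 vA]; exists (fun i => v 0 i).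
    have sq0 i : 0 <= v 0 i ^+ 2 by rewrite sqr_ge0.
    rewrite lt_neqAle sumr_ge0 // andbT eq_sym; apply: contra v0 => /eqP s0.
    apply/eqP/rowP => i; rewrite mxE; apply/eqP; rewrite -sqrf_eq0.
    by rewrite (psumr_eq0P _ s0).
  move=> i; have /rowP/(_ i) := vA; rewrite !mxE => e; rewrite -[RHS]e.
  by apply: eq_bigr => j _; rewrite mxE symA mulrC.
move=> [u u0 uA]; apply/eqP/det0P; exists (\row_i u i).
  apply: contraTneq u0 => /rowP e; rewrite big1 ?ltxx // => i _.
  by have := e i; rewrite !mxE => ->; rewrite expr0n.
apply/rowP => i; rewrite !mxE -[RHS](uA i); apply: eq_bigr => j _.
by rewrite !mxE symA mulrC.
Qed.

(** By symmetry the column sums are s too. Hence [A] preserves zero sums, and for s <> 0 its kernel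
    vectors have zero sum. *)
Lemma sum_mul_const_rowsum {R : realType} {I : finType} (A : I -> I -> R) (s : R)
    (u : I -> R) :
  (forall i j, A i j = A j i) -> (forall i, \sum_j A i j = s) ->
  \sum_i \sum_j A i j * u j = s * \sum_j u j.
Proof.
move=> symA rs; rewrite exchange_big mulr_sumr; apply: eq_bigr => j _ /=.
by rewrite -mulr_suml -(rs j); congr (_ * _); apply: eq_bigr => i _.
Qed.

(** Cauchy-Schwarz of u against w = A u, which again has zero sum, bounds the square of |w|^2 by
    0. *)
Lemma negtype_isotropic {R : realType} {I : finType} (A : I -> I -> R) (s : R)
    (u : I -> R) :
  (forall i j, A i j = A j i) -> (forall i, \sum_j A i j = s) -> negtype A ->
  \sum_i u i = 0 -> qform A u = 0 -> forall i, \sum_j A i j * u j = 0.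
Proof.
move=> symA rs nA u0 qu i; pose w i := \sum_j A i j * u j.
have w0 : \sum_i w i = 0 by rewrite (sum_mul_const_rowsum _ _ _ symA rs) u0 mulr0.
have := negtype_cauchy A u w symA nA u0 w0; rewrite qu mul0r => h.
have /eqP : (\sum_i w i * w i) ^+ 2 = 0 by apply: le_anti; rewrite h sqr_ge0.
rewrite sqrf_eq0 => /eqP/psumr_eq0P => /(_ (fun i _ => sqr_ge0 (w i)) i isT)/eqP.
by rewrite mulf_eq0 orbb => /eqP.
Qed.

(* With [y = A^-1 x], the Cauchy-Schwarz inequality for the form [- A] on zero-sum
   vectors gives [(x, x)^2 = (x, A y)^2 <= (x, A x) (y, A y)]. *)
Lemma negtype_coercive {R : realType} {n : nat} (A : 'I_n -> 'I_n -> R) (s : R) :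
  (forall i j, A i j = A j i) -> (forall i, \sum_j A i j = s) -> s != 0 ->
  negtype A -> \det (\matrix_(i, j) A i j) != 0 ->
  exists2 c, 0 < c &
    forall x, \sum_i x i = 0 -> qform A x <= - (c * \sum_i x i ^+ 2).
Proof.
move=> symA rs s0 nA detA; set M := \matrix_(i, j) A i j in detA.
have uM : M \in unitmx by rewrite unitmxE unitfE.
pose W i j := invmx M i j.
pose K := \sum_i \sum_j `|W i j|.
have K0 : 0 <= K by apply: sumr_ge0 => i _; apply: sumr_ge0.
have K1 : 0 < K + 1 by rewrite ltr_wpDl.
(* [K] bounds the form of the inverse matrix relative to |x|^2; adding 1 makes it positive. *)
exists (K + 1)^-1; first by rewrite invr_gt0.
move=> x x0; set N := \sum_i x i ^+ 2.
pose y i := \sum_j W i j * x j.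
have Ay i : \sum_j A i j * y j = x i.
  have := mulmxV uM => /(congr1 (fun B => (B *m \col_k x k) i 0)).
  rewrite mul1mx -mulmxA !mxE => e; rewrite -[RHS]e; apply: eq_bigr => j _.
  by rewrite !mxE; congr (_ * _); apply: eq_bigr => k _; rewrite mxE.
have y0 : \sum_i y i = 0.
  have := sum_mul_const_rowsum A s y symA rs.
  rewrite (eq_bigr x) // x0 => /esym/eqP.
  by rewrite mulf_eq0 (negPf s0) => /eqP.
have := negtype_cauchy A y x symA nA y0 x0.
have -> : \sum_i x i * (\sum_j A i j * y j) = N.
  by apply: eq_bigr => i _; rewrite Ay.
have -> : qform A y = qform W x.
  (* Pair y with x, once through x = A y and once through y = W x. *)
  transitivity (\sum_i y i * x i).
    apply: eq_bigr => i _; rewrite -(Ay i) mulr_sumr; apply: eq_bigr => j _; ring.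
  apply: eq_bigr => i _; rewrite mulr_suml; apply: eq_bigr => j _; ring.
have := qform_norm_le W x; rewrite -/N -/K ler_norml => /andP[hW _] hN.
have N0 : 0 <= N by apply: sumr_ge0 => i _; rewrite sqr_ge0.
have qx := nA x x0.
have [N00|Np] := eqVneq N 0; first by rewrite N00 mulr0 oppr0.
have {}Np : 0 < N by rewrite lt_neqAle eq_sym Np.
rewrite lerNr mulrC ler_pdivrMr //.
have : N * N <= N * ((K + 1) * - qform A x).
  apply: (le_trans (_ : N * N <= (K * N) * - qform A x)).
    rewrite -expr2; apply: (le_trans hN); rewrite -mulrNN.
    by apply: ler_wpM2r; rewrite ?oppr_ge0 // lerNl.
  have := mulr_ge0 N0 (_ : 0 <= - qform A x); rewrite oppr_ge0 => /(_ qx); lra.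
by rewrite ler_pM2l // mulrC.
Qed.

Lemma dpow_cvg {R : realType} (c p : R) : 0 <= c ->
  (dpow c t @[t --> p] --> dpow c p)%classic.
Proof.
move=> c0; rewrite /dpow; case: eqVneq => [_|cn]; first exact: cvg_cst.
rewrite /powR (negPf cn).
apply: (cvg_comp (fun t => t * ln c) expR).
  by apply: cvgMr_tmp; exact: cvg_id.
exact: continuous_expR.
Qed.

(** Nonnegativity comes from the triangle inequality along i, j, i. *)
Lemma metric_gt0 {R : realType} {I : eqType} (d : I -> I -> R) (i j : I) :
  is_metric d -> i != j -> 0 < d i j.
Proof.
move=> [d0 [symd tri]] ij.
have := tri i j i; rewrite (symd j i) (proj2 (d0 i i) erefl) => h.
rewrite lt_neqAle; apply/andP; split; last by lra.
by apply: contra ij => /eqP/esym/d0 ->.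
Qed.

Lemma metric_dpowE {R : realType} {I : eqType} (d : I -> I -> R) (p : R) (i j : I) :
  is_metric d -> dpow (d i j) p = if i == j then 0 else d i j `^ p.
Proof.
move=> hd; rewrite /dpow; case: (eqVneq i j) => [->|ij].
  by case: hd => d0 _; rewrite (proj2 (d0 j j) erefl) eqxx.
by rewrite gt_eqF // metric_gt0.
Qed.

Lemma metric_dpow_sym {R : realType} {I : eqType} (d : I -> I -> R) (p : R) (i j : I) :
  is_metric d -> dpow (d i j) p = dpow (d j i) p.
Proof. by case=> _ [symd _]; rewrite symd. Qed.

(** At exponent 0 the matrix is the all-ones matrix minus the identity. *)
Lemma qform_dpow0 {R : realType} {I : finType} (d : I -> I -> R) (x : I -> R) :
  is_metric d ->
  qform (fun i j => dpow (d i j) 0) x = (\sum_i x i) ^+ 2 - \sum_i x i ^+ 2.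
Proof.
move=> hd; rewrite (@eq_qform _ _ _ (fun i j => 1 + if i == j then - 1 else 0)).
  by rewrite qformD qform_const qform_diag mul1r mulN1r.
by move=> i j; rewrite metric_dpowE // powRr0; case: eqP; rewrite ?subrr ?addr0.
Qed.

(** This is [negtype_powR] with exponent p / q; p = 0 falls outside its range and is computed
    directly. *)
Lemma distance_negtype_strict {R : realType} {I : finType} (d : I -> I -> R) (p q : R)
    (x : I -> R) :
  is_metric d -> 0 <= p < q -> negtype (fun i j => dpow (d i j) q) ->
  \sum_i x i = 0 -> 0 < \sum_i x i ^+ 2 -> qform (fun i j => dpow (d i j) p) x < 0.
Proof.
move=> hd /andP[p0 pq] nq x0 Np; have q0 : 0 < q by apply: le_lt_trans pq.
have [->|pn] := eqVneq p 0.
  by rewrite qform_dpow0 // x0 expr0n add0r oppr_lt0.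
rewrite (@eq_qform _ _ _ (fun i j => if i == j then 0 else dpow (d i j) q `^ (p / q))).
  apply: negtype_powR => // [i j|i|i j ij|].
  - exact: metric_dpow_sym.
  - by rewrite metric_dpowE // eqxx.
  - by rewrite metric_dpowE // (negPf ij) powR_gt0 // metric_gt0.
  - by rewrite ltr_pdivrMr // mul1r pq divr_gt0 // lt_neqAle eq_sym pn.
move=> i j; rewrite !metric_dpowE //; case: eqP => // _.
by rewrite -powRrM mulrC divfK // gt_eqF.
Qed.

Lemma qform_dpow_cvg {R : realType} {I : finType} (d : I -> I -> R) (q : R) (x : I -> R) :
  is_metric d ->
  (qform (fun i j => dpow (d i j) p) x @[p --> q]
     --> qform (fun i j => dpow (d i j) q) x)%classic.
Proof.
move=> hd; apply: qform_cvg => i j; apply: dpow_cvg.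
have [->|ij] := eqVneq i j; last by rewrite ltW // metric_gt0.
by case: hd => d0 _; rewrite (proj2 (d0 j j) erefl).
Qed.

(** [negtype_coercive] leaves a margin c |x|^2 at q, and the entrywise distance f p from the matrix
    at q stays below c for p close to q. *)
Lemma distance_negtype_open {R : realType} {n : nat} (d : 'I_n -> 'I_n -> R) (q s : R) :
  is_metric d -> (forall i, \sum_j dpow (d i j) q = s) -> s != 0 ->
  negtype (fun i j => dpow (d i j) q) -> \det (distmx d q) != 0 ->
  exists2 p, q < p & negtype (fun i j => dpow (d i j) p).
Proof.
move=> hd rs s0 nq dq.
have [c c0 hc] := negtype_coercive (fun i j => dpow (d i j) q) s
  (fun i j => metric_dpow_sym d q i j hd) rs s0 nq dq.
pose f p := \sum_i \sum_j `|dpow (d i j) p - dpow (d i j) q|.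
have fcvg : (f p @[p --> q] --> (0 : R))%classic.
  have -> : 0 = \sum_(i < n) \sum_(j < n) `|dpow (d i j) q - dpow (d i j) q|.
    by rewrite big1 // => i _; rewrite big1 // => j _; rewrite subrr normr0.
  apply: cvg_big => // [|i _]; first exact: add_continuous.
  apply: cvg_big => // [|j _]; first exact: add_continuous.
  apply: cvg_norm; apply: cvgB; last exact: cvg_cst.
  apply: dpow_cvg; have [->|ij] := eqVneq i j; last by rewrite ltW // metric_gt0.
  by case: hd => d0 _; rewrite (proj2 (d0 j j) erefl).
have /nbhs_ballP [e /= e0 he] : nbhs q [set p | f p <= c]%classic.
  exact: (cvgr_le _ fcvg _ c0).
exists (q + e / 2); first by rewrite ltrDl divr_gt0.
have fe : f (q + e / 2) <= c.
  apply: he; rewrite /ball /= opprD addrA subrr add0r normrN gtr0_norm ?divr_gt0 //.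
  by rewrite gtr_pMr // invf_lt1 // ltr1n.
move=> x x0; move: (q + e / 2) fe => p fe.
rewrite (@eq_qform _ _ _ (fun i j => dpow (d i j) q + (dpow (d i j) p - dpow (d i j) q))).
  have : `|qform (fun i j => dpow (d i j) p - dpow (d i j) q) x|
      <= f p * \sum_i x i ^+ 2 by exact: qform_norm_le.
  rewrite ler_norml => /andP[_ h]; rewrite [leLHS]qformD.
  have N0 : 0 <= \sum_i x i ^+ 2 by apply: sumr_ge0 => i _; rewrite sqr_ge0.
  have := ler_wpM2r N0 fe; have := hc x x0; move: h.
  by move: (qform _ _) (qform _ _) (f p * _) (c * _) => a b r t; lra.
by move=> i j; rewrite addrC subrK.
Qed.

(** Permuting a row permutes its p-th powers, so the assumption on distances serves every p. *)
Lemma rowsum_dpow {R : realType} {n : nat} (d : 'I_n -> 'I_n -> R) (p : R) (i0 i : 'I_n) :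
  perm_eq [seq d i j | j <- enum 'I_n] [seq d i0 j | j <- enum 'I_n] ->
  \sum_j dpow (d i j) p = \sum_j dpow (d i0 j) p.
Proof.
move=> pe.
have e k : \sum_j dpow (d k j) p = \sum_(c <- [seq d k j | j <- enum 'I_n]) dpow c p.
  by rewrite big_map big_enum.
by rewrite !e; exact: perm_big.
Qed.

Lemma rowsum_dpow_gt0 {R : realType} {n : nat} (d : 'I_n -> 'I_n -> R) (p : R) (i : 'I_n) :
  (2 <= n)%N -> is_metric d -> 0 < \sum_j dpow (d i j) p.
Proof.
move=> n2 hd.
have ge0 j : 0 <= dpow (d i j) p.
  by rewrite metric_dpowE //; case: eqP => // _; exact: powR_ge0.
have /card_gt0P [j] : (0 < #|[pred j | j != i]|)%N.
  by have := cardC1 i; rewrite card_ord => ->; rewrite -subn1 subn_gt0.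
rewrite inE => ji; rewrite (bigD1 j) //= ltr_wpDr ?sumr_ge0 //.
by rewrite metric_dpowE // eq_sym (negPf ji) powR_gt0 // metric_gt0 // eq_sym.
Qed.

(** A kernel vector would have zero sum, since s <> 0, and zero form, against
    [distance_negtype_strict]. *)
Lemma det_distmx_neq0 {R : realType} {n : nat} (d : 'I_n -> 'I_n -> R) (p q s : R) :
  is_metric d -> (forall i, \sum_j dpow (d i j) p = s) -> s != 0 ->
  0 <= p < q -> negtype (fun i j => dpow (d i j) q) -> \det (distmx d p) != 0.
Proof.
move=> hd rs s0 pq nq; apply/eqP.
have symD i j := metric_dpow_sym d p i j hd.
move/(proj1 (det0_kernel _ symD)) => [u u0 Du].
have su : \sum_i u i = 0.
  have /eqP : s * \sum_j u j = 0 by rewrite -(sum_mul_const_rowsum _ s u symD rs) big1.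
  by rewrite mulf_eq0 (negPf s0) => /eqP.
have := distance_negtype_strict d p q u hd pq nq su u0.
rewrite (_ : qform _ u = 0) ?ltxx //.
rewrite /qform big1 // => i _.
rewrite (eq_bigr (fun j => u i * (dpow (d i j) p * u j))) => [|j _]; last by ring.
by rewrite -mulr_sumr Du mulr0.
Qed.

Lemma gr_exponent0 {R : realType} {I : finType} (d : I -> I -> R) :
  is_metric d -> gr_exponent d 0.
Proof.
move=> hd; apply/gr_exponentE => //; split=> // x x0.
rewrite qform_dpow0 // x0 expr0n add0r oppr_le0.
by rewrite sumr_ge0 // => i _; rewrite sqr_ge0.
Qed.

(** A zero-sum vector with positive form at q would keep it positive at all nearby exponents, yet
    roundness exponents come arbitrarily close to q from below. *)
Lemma genroundness_attained {R : realType} {I : finType} (d : I -> I -> R) (q : R) :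
  is_metric d -> genroundness d = (q%:E)%E -> gr_exponent d q.
Proof.
move=> hd gq.
have ub p : gr_exponent d p -> p <= q.
  by move=> gp; rewrite -lee_fin -gq; apply: ereal_sup_ubound; exists p.
have gr0 := gr_exponent0 d hd.
apply/gr_exponentE => //; split=> [|x x0]; first exact: ub.
rewrite leNgt; apply/negP => qx.
have /nbhs_ballP [e /= e0 he] :
    nbhs q [set p | 0 < qform (fun i j => dpow (d i j) p) x]%classic.
  exact: (cvgr_gt _ (qform_dpow_cvg d q x hd) _ qx).
have [p gp pe] : exists2 p, gr_exponent d p & q - e < p.
  apply: contrapT => no; have : (genroundness d <= (q - e)%:E)%E.
    apply: ge_ereal_sup => _ [p gp <-]; rewrite lee_fin leNgt.
    by apply/negP => h; apply: no; exists p.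
  by rewrite gq lee_fin leNgt ltrBlDr ltrDl e0.
have : 0 < qform (fun i j => dpow (d i j) p) x.
  apply: he; rewrite /ball /= ger0_norm ?subr_ge0 ?ub //; lra.
by move/(gr_exponentE _ _ hd): gp => [_ np]; rewrite ltNge np.
Qed.

Theorem theorem3p1 (R : realType) (n : nat) (n2 : (2 <= n)%N)
  (d : 'I_n -> 'I_n -> R) (hd : is_metric d)
  (hrows : forall i : 'I_n,
     perm_eq [seq d i j | j <- enum 'I_n]
             [seq d (@Ordinal n 0 (ltnW n2)) j | j <- enum 'I_n]) :
  genroundness d =
    ereal_inf [set (p%:E)%E | p in [set p : R | 0 <= p /\ \det (distmx d p) = 0]]
  /\
  (forall q : R, genroundness d = (q%:E)%E ->
     forall u : 'cV[R]_n,
       ((\sum_(i < n) u i 0 = 0) /\ (u^T *m distmx d q *m u) 0 0 = 0)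
       <-> distmx d q *m u = 0).
Proof.
pose s p := \sum_j dpow (d (@Ordinal n 0 (ltnW n2)) j) p.
have rs p i : \sum_j dpow (d i j) p = s p by apply: rowsum_dpow.
have s0 p : s p != 0 by rewrite gt_eqF // rowsum_dpow_gt0.
have symD p i j := metric_dpow_sym d p i j hd.
have gr0 := gr_exponent0 d hd.
split.
  apply: le_anti; apply/andP; split.
    (* No roundness exponent exceeds a zero of the determinant, by [det_distmx_neq0]. *)
    apply: ge_ereal_sup => _ [p /(gr_exponentE _ _ hd) [p0 np] <-].
    apply: le_ereal_inf_tmp => _ [z [z0 dz] <-]; rewrite lee_fin leNgt; apply/negP => zp.
    by have := det_distmx_neq0 d z p _ hd (rs z) (s0 z); rewrite z0 zp dz eqxx => /(_ isT np).
  (* The exponent 0 excludes the value -oo; for +oo the inequality is trivial. *)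
  have : ((0 : R)%:E <= genroundness d)%E.
    by rewrite /genroundness; apply: ereal_sup_ubound; exists (0 : R).
  case E : (genroundness d) => [q| |]; [|by move=> _; rewrite leey|by rewrite leeNy_eq].
  rewrite lee_fin => q0; apply: ereal_inf_lbound; exists q => //; split=> //.
  (* An invertible matrix at q would let negative type extend past the supremum. *)
  apply/eqP/negPn/negP => dq.
  have /(gr_exponentE _ _ hd) [_ nq] := genroundness_attained d q hd E.
  have [p qp np] := distance_negtype_open d q _ hd (rs q) (s0 q) nq dq.
  have : (p%:E <= genroundness d)%E.
    apply: ereal_sup_ubound; exists p => //=; apply/(gr_exponentE _ _ hd); split=> //.
    exact: ltW (le_lt_trans q0 qp).
  by rewrite E lee_fin leNgt qp.
move=> q gq u.
have /(gr_exponentE _ _ hd) [_ nq] := genroundness_attained d q hd gq.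
have Dq : (u^T *m distmx d q *m u) 0 0 = qform (fun i j => dpow (d i j) q) (fun i => u i 0).
  rewrite /qform exchange_big mxE; apply: eq_bigr => j _.
  by rewrite !mxE mulr_suml; apply: eq_bigr => i _; rewrite !mxE; ring.
have Du i : (distmx d q *m u) i 0 = \sum_j dpow (d i j) q * u j 0.
  by rewrite mxE; apply: eq_bigr => j _; rewrite mxE.
split=> [[u0]|Du0].
  rewrite Dq => qu; apply/colP => i; rewrite Du mxE.
  exact: (negtype_isotropic _ _ (fun i => u i 0) (symD q) (rs q) nq u0 qu).
split; last by rewrite -mulmxA Du0 mulmx0 mxE.
(* Adding up the rows of D_q u = 0 gives [s q] times the sum of u, and [s q] is nonzero. *)
have /eqP : s q * \sum_j u j 0 = 0.
  rewrite -(sum_mul_const_rowsum _ _ (fun i => u i 0) (symD q) (rs q)) big1 // => i _.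
  by rewrite -Du Du0 mxE.
by rewrite mulf_eq0 (negPf (s0 q)) => /eqP.
Qed.
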